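(* Let $X \in \mathbb{R}^{n\times p}$ be a matrix all of whose columns are nonzero, let $y \in \mathbb{R}^n$, let $\delta > 0$, and let $D$ be the $p \times p$ diagonal matrix whose $i$-th diagonal entry is the $\ell_2$ norm of the $i$-th column of $X$. Set $$A := D^{-1}X^\top X \in \mathbb{R}^{p\times p}, \qquad b := D^{-1}X^\top y \in \mathbb{R}^p, \qquad \mathcal{C} := \{u \in \mathbb{R}^p : \|u-b\|_\infty \le \delta\},$$ and consider the optimization problem $$\text{(P)}\qquad \min\{\|\beta\|_1 + \iota_{\mathcal{C}}(A\beta) : \beta \in \mathbb{R}^p\}.$$ If $\beta \in \mathbb{R}^p$ is a solution (i.e. a minimizer) of (P), then for any $\alpha > 0$ and $\lambda > 0$ there exists a vector $\tau \in \mathbb{R}^p$ such that $$\beta = \mathrm{prox}_{\frac{1}{\alpha}\|\cdot\|_1}\left(\beta - \frac{\lambda}{\alpha}A^\top \tau\right) \qquad\text{and}\qquad \tau = (I - \mathrm{prox}_{\iota_{\mathcal{C}}})(A\beta + \tau).$$ Conversely, if there exist $\alpha > 0$ and $\lambda > 0$ such that $\beta, \tau \in \mathbb{R}^p$ satisfy these two equations, then $\beta$ is a solution of (P).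
   Context: For a closed convex set $\mathcal{C} \subseteq \mathbb{R}^d$, the indicator function $\iota_{\mathcal{C}} : \mathbb{R}^d \to (-\infty,+\infty]$ is $\iota_{\mathcal{C}}(u) = 0$ if $u \in \mathcal{C}$ and $+\infty$ otherwise. For a lower semicontinuous convex function $f : \mathbb{R}^d \to (-\infty,+\infty]$ that is not identically $+\infty$, and a parameter $\lambda > 0$, the proximity operator $\mathrm{prox}_{\lambda f} : \mathbb{R}^d \to \mathbb{R}^d$ is defined by $$\mathrm{prox}_{\lambda f}(x) := \mathrm{argmin}\left\{\frac{1}{2\lambda}\|u-x\|_2^2 + f(u) : u \in \mathbb{R}^d\right\}$$ (the minimizer is unique). In particular, $\mathrm{prox}_{\frac1\alpha\|\cdot\|_1}$ is this operator with $f = \|\cdot\|_1$ and parameter $1/\alpha$, and $\mathrm{prox}_{\iota_{\mathcal{C}}}$ is this operator with $f = \iota_{\mathcal{C}}$ and parameter $1$. $I$ denotes the identity map on $\mathbb{R}^p$. *)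

(* Defs.v *)
From HB Require Import structures.
From mathcomp Require Import all_boot all_order all_algebra.
From mathcomp Require Import all_classical all_reals ereal topology normedtype.

Set Implicit Arguments.
Unset Strict Implicit.
Unset Printing Implicit Defensive.

Import Order.TTheory GRing.Theory Num.Theory.
Import numFieldNormedType.Exports.

Local Open Scope classical_set_scope.
Local Open Scope ring_scope.

(* The l_infinity norm is the library norm `|u| on 'cV[R]_d: the norm instance
   on matrices is mx_norm, the maximum of the absolute values of the entries. *)

Definition l1norm (R : realType) (d : nat) (u : 'cV[R]_d) : R :=
  \sum_(i < d) `|u i 0|.

Definition l2norm (R : realType) (d : nat) (u : 'cV[R]_d) : R :=
  Num.sqrt (\sum_(i < d) u i 0 ^+ 2).

Definition indicator (R : realType) (d : nat) (C : set 'cV[R]_d)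
    (u : 'cV[R]_d) : \bar R :=
  if u \in C then 0%E else +oo%E.

Definition argmin (R : realType) (T : Type) (F : T -> \bar R) : set T :=
  [set x | forall u, (F x <= F u)%E].

(* When f is proper, lower semicontinuous and convex and lambda > 0, the argmin
   below is a singleton, of which [get] returns the element; for other f or
   lambda the value is not meaningful. *)
Definition prox (R : realType) (d : nat) (lambda : R) (f : 'cV[R]_d -> \bar R)
    (x : 'cV[R]_d) : 'cV[R]_d :=
  get (argmin (fun u => ((2 * lambda)^-1 * l2norm (u - x) ^+ 2)%:E + f u)%E).

Definition colnorm_mx (R : realType) (n p : nat) (X : 'M[R]_(n, p)) : 'M[R]_p :=
  diag_mx (\row_(i < p) l2norm (col i X)).

(* Main.v *)
Require Import Defs.
From HB Require Import structures.
From mathcomp Require Import all_boot all_order all_algebra.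
From mathcomp Require Import all_classical all_reals ereal topology normedtype.
From mathcomp Require Import ring lra.

(** Both equations are first-order optimality conditions. A point z is the
    proximity point of x for f exactly when (x - z) / lambda is a subgradient
    of f at z ([prox_eqP]), so the two fixed-point equations say that
    - lambda A^T tau is a subgradient of the l1 norm at beta and that tau is
    normal to the box C at A beta.

    These two conditions suffice for optimality: for a feasible u, the
    subgradient inequality bounds |u|_1 - |beta|_1 below by
    - lambda <tau, A u - A beta>, which is nonnegative by normality.

    Conversely a minimizer must have such a multiplier tau. The problem is a
    linear program, and Farkas' lemma ([farkas]), applied to a homogenization of
    the optimality of beta, produces the multiplier ([l1_box_multiplier]). The
    minimizer is feasible because some point is: the normal equations
    X^T X u = X^T y always have a solution, and it satisfies A u = b
    ([normal_equations_solvable]). Normality to C is invariant under positive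
    scaling, so dividing the multiplier by lambda gives tau. *)

Set Implicit Arguments.
Unset Strict Implicit.
Unset Printing Implicit Defensive.

Import Order.TTheory GRing.Theory Num.Theory.
Import numFieldNormedType.Exports.

Local Open Scope classical_set_scope.
Local Open Scope ring_scope.

(** * Farkas' lemma *)

(** Induction on the number of functionals. If c is not a nonnegative
    combination of the functionals a i for i in s, some x has a i x >= 0 on s
    but c x < 0, so the remaining functional a i0 must be negative at x. Composing
    the other functionals with the projection onto the kernel of a i0 along x
    amounts to adding multiples of a i0 to them. The induction hypothesis
    applies to the results, and its combination unfolds into one of the
    original functionals whose coefficient at i0 is nonnegative because of the
    signs at x. *)
Lemma farkas_seq (F : realFieldType) (V : lmodType F) (I : eqType) (s : seq I)
    (a : I -> V -> F) (c : V -> F) :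
  uniq s -> (forall i, scalar (a i)) -> scalar c ->
  (forall x, {in s, forall i, 0 <= a i x} -> 0 <= c x) ->
  exists2 y : I -> F, forall i, 0 <= y i &
    forall x, c x = \sum_(i <- s) y i * a i x.
Proof.
elim: s a c => [|i0 s IHs] a c /=.
  move=> _ _ lin_c c_ge0; exists (fun=> 0) => // x; rewrite big_nil.
  have cN : c (- x) + c x = 0.
    by have := lin_c (-1) x 0; have := lin_c (-1) 0 0;
       rewrite scaler0 !addr0 scaleN1r => *; lra.
  have c_nil z : 0 <= c z by apply: c_ge0.
  by have := c_nil x; have := c_nil (- x); lra.
move=> /andP[i0s uniq_s] lin_a lin_c c_ge0.
have extend t (y : I -> F) x :
    \sum_(i <- s) (if i == i0 then t else y i) * a i x =
    \sum_(i <- s) y i * a i x.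
  apply: eq_big_seq => i si; case: eqVneq => // ii0.
  by rewrite -ii0 si in i0s.
have [[y y_ge0 cE]|notin_cone] := pselect (exists2 y : I -> F,
    forall i, 0 <= y i & forall x, c x = \sum_(i <- s) y i * a i x).
  exists (fun i => if i == i0 then 0 else y i) => [i|x]; first by case: eqP.
  by rewrite big_cons eqxx mul0r add0r extend.
have [x [ax_ge0 cx_lt0]] : exists x, {in s, forall i, 0 <= a i x} /\ c x < 0.
  apply: contrapT => no_x; apply/notin_cone/IHs => // x ax_ge0.
  by rewrite leNgt; apply/negP => cx_lt0; apply: no_x; exists x.
have a0x_lt0 : a i0 x < 0.
  rewrite ltNge; apply/negP => a0x_ge0; move: cx_lt0; apply/negP; rewrite -leNgt.
  by apply: c_ge0 => i; rewrite inE => /predU1P[->|/ax_ge0].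
(* z |-> k z *: x + z is the projection onto the kernel of a i0 along x. *)
pose k z := a i0 z / - a i0 x.
have lin_k f : scalar f -> scalar (fun z => f z + k z * f x).
  by move=> lin_f r u v; rewrite /k lin_f lin_a; ring.
have [y y_ge0 cE] : exists2 y : I -> F, forall i, 0 <= y i &
    forall z, c z + k z * c x = \sum_(i <- s) y i * (a i z + k z * a i x).
  apply: (IHs (fun i z => a i z + k z * a i x) (fun z => c z + k z * c x)) => //.
  - by move=> i; exact: lin_k.
  - exact: lin_k.
  move=> z a'z_ge0.
  have shiftE f : scalar f -> f (k z *: x + z) = f z + k z * f x.
    by move=> ->; rewrite addrC.
  rewrite -shiftE //; apply: c_ge0 => i; rewrite inE shiftE // => /predU1P[->|].
    suff -> : a i0 z + k z * a i0 x = 0 by [].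
    by rewrite /k; field; lra.
  exact: a'z_ge0.
pose t := (\sum_(i <- s) y i * a i x - c x) / - a i0 x.
exists (fun i => if i == i0 then t else y i) => [i|z].
  case: ifP => // _; apply: divr_ge0; last by lra.
  suff: 0 <= \sum_(i <- s) y i * a i x by lra.
  by rewrite big_seq sumr_ge0 // => j sj; rewrite mulr_ge0 ?ax_ge0.
rewrite big_cons eqxx extend.
have := cE z; under eq_bigr do rewrite mulrDr mulrCA.
rewrite big_split /= -mulr_sumr => cE'.
have -> : t * a i0 z = k z * (\sum_(i <- s) y i * a i x - c x).
  by rewrite /t /k; ring.
by move: cE'; set S := \sum_(i <- s) y i * a i x => ?; lra.
Qed.

Lemma farkas (F : realFieldType) (V : lmodType F) (I : finType)
    (a : I -> V -> F) (c : V -> F) :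
  (forall i, scalar (a i)) -> scalar c ->
  (forall x, (forall i, 0 <= a i x) -> 0 <= c x) ->
  exists2 y : I -> F, forall i, 0 <= y i & forall x, c x = \sum_i y i * a i x.
Proof.
move=> lin_a lin_c c_ge0.
apply: farkas_seq (index_enum_uniq I) lin_a lin_c _ => x ax_ge0.
by apply: c_ge0 => i; apply: ax_ge0; rewrite mem_index_enum.
Qed.

(** * Proximity points and subgradients *)

Definition dot (R : realType) (d : nat) (u v : 'cV[R]_d) : R :=
  \sum_(i < d) u i 0 * v i 0.

Lemma dotZl (R : realType) (d : nat) (k : R) (u v : 'cV[R]_d) :
  dot (k *: u) v = k * dot u v.
Proof. by rewrite /dot mulr_sumr; apply: eq_bigr => i _; rewrite mxE mulrA. Qed.

Lemma dotBr (R : realType) (d : nat) (u v w : 'cV[R]_d) :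
  dot u (v - w) = dot u v - dot u w.
Proof.
by rewrite /dot -sumrB; apply: eq_bigr => i _; rewrite !mxE mulrBr.
Qed.

Lemma dot_trmx (R : realType) (m d : nat) (A : 'M[R]_(m, d)) t u :
  dot (A^T *m t) u = dot t (A *m u).
Proof.
have dotE k (v w : 'cV[R]_k) : dot v w = (v^T *m w) 0 0.
  by rewrite mxE; apply: eq_bigr => i _; rewrite mxE.
by rewrite !dotE trmx_mul trmxK mulmxA.
Qed.

Lemma sqr_l2norm (R : realType) (d : nat) (u : 'cV[R]_d) :
  l2norm u ^+ 2 = dot u u.
Proof.
rewrite sqr_sqrtr; last by apply: sumr_ge0 => i _; exact: sqr_ge0.
by apply: eq_bigr => i _; rewrite expr2.
Qed.

Lemma l2norm_sqr_le0 (R : realType) (d : nat) (u : 'cV[R]_d) :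
  l2norm u ^+ 2 <= 0 -> u = 0.
Proof.
rewrite sqr_l2norm => dot_le0; apply/colP => i; rewrite mxE.
have sq_ge0 (j : 'I_d) : true -> 0 <= u j 0 * u j 0.
  by rewrite -expr2 sqr_ge0.
have /psumr_eq0P : \sum_j u j 0 * u j 0 = 0.
  by apply: le_anti; rewrite [_ <= 0]dot_le0 sumr_ge0.
by move=> /(_ sq_ge0 i isT) /eqP; rewrite mulf_eq0 orbb => /eqP.
Qed.

(** Requiring f z to be finite excludes the inequalities that hold for a trivial
    reason, where f z is -oo or f is identically +oo. *)
Definition subgradient (R : realType) (d : nat) (f : 'cV[R]_d -> \bar R)
    (z g : 'cV[R]_d) : Prop :=
  f z \is a fin_num /\ forall u, (f z + (dot g (u - z))%:E <= f u)%E.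

(** Expanding the square shows that the objective at u exceeds its value at z by
    at least |u - z|^2 / (2 lambda), hence z is the unique minimizer. *)
Lemma prox_subgradient (R : realType) (d : nat) (lambda : R)
    (f : 'cV[R]_d -> \bar R) (x z : 'cV[R]_d) :
  0 < lambda -> subgradient f z (lambda^-1 *: (x - z)) -> prox lambda f x = z.
Proof.
move=> lambda_gt0 [fz_fin sub_f].
pose F u := (((2 * lambda)^-1 * l2norm (u - x) ^+ 2)%:E + f u)%E.
have growth u :
    (F z + ((2 * lambda)^-1 * l2norm (u - z) ^+ 2)%:E <= F u)%E.
  have expand : (2 * lambda)^-1 * l2norm (u - x) ^+ 2 =
      (2 * lambda)^-1 * l2norm (z - x) ^+ 2 - dot (lambda^-1 *: (x - z)) (u - z)
      + (2 * lambda)^-1 * l2norm (u - z) ^+ 2.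
    rewrite !sqr_l2norm /dot !mulr_sumr -sumrB -big_split /=.
    by apply: eq_bigr => i _; rewrite !mxE; field; rewrite gt_eqF.
  rewrite /F expand; have := sub_f u.
  case: (f z) fz_fin => // r _; case: (f u) => [s| |] //=; last first.
    by rewrite addey ?leey.
  by rewrite -!EFinD !lee_fin => ?; lra.
have Fz_fin : F z \is a fin_num by rewrite fin_numD fz_fin.
have coef_gt0 : 0 < (2 * lambda)^-1 by rewrite invr_gt0 mulr_gt0.
have z_min : argmin F z.
  move=> u; apply: le_trans (growth u); rewrite leeDl // lee_fin.
  by rewrite mulr_ge0 ?sqr_ge0 ?ltW.
rewrite /prox -/F; case: xgetP => [w _ w_min|no_min]; last by case: (no_min z).
have := le_trans (growth w) (w_min z).
rewrite -[leRHS]adde0 leeD2lE // lee_fin pmulr_rle0 // => /l2norm_sqr_le0.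
by move/eqP; rewrite subr_eq0 => /eqP.
Qed.

(** [prox] chooses an element of the argmin, so the implication from left to
    right needs the argmin to be nonempty. The existence hypothesis provides
    this through [prox_subgradient]; for the two functions of interest it is
    discharged by the explicit solutions below. *)
Lemma prox_eqP (R : realType) (d : nat) (lambda : R) (f : 'cV[R]_d -> \bar R)
    (x z : 'cV[R]_d) :
  0 < lambda -> (exists z0, subgradient f z0 (lambda^-1 *: (x - z0))) ->
  z = prox lambda f x <-> subgradient f z (lambda^-1 *: (x - z)).
Proof.
move=> lambda_gt0 [z0 sub0]; split=> [->|/(prox_subgradient lambda_gt0)->//].
by rewrite (prox_subgradient lambda_gt0 sub0).
Qed.

Lemma subgradient_l1P (R : realType) (d : nat) (z g : 'cV[R]_d) :
  subgradient (fun u => (l1norm u)%:E) z g <->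
  forall u, l1norm z + dot g (u - z) <= l1norm u.
Proof.
split=> [[_ sub] u|sub]; first by rewrite -lee_fin EFinD; exact: sub.
by split=> // u; rewrite -EFinD lee_fin; exact: sub.
Qed.

Lemma subgradient_indicatorP (R : realType) (d : nat) (C : set 'cV[R]_d)
    (z g : 'cV[R]_d) :
  subgradient (indicator C) z g <->
  C z /\ forall u, C u -> dot g (u - z) <= 0.
Proof.
rewrite /subgradient /indicator; split.
  case: ifPn => [|_ [//]]; rewrite inE => Cz [_ sub]; split=> // u Cu.
  by have := sub u; rewrite mem_set // add0e lee_fin.
move=> [Cz sub]; rewrite mem_set //; split=> // u; rewrite add0e.
by case: ifPn => [|_]; [rewrite inE lee_fin => /sub | exact: leey].
Qed.

(** The l1 norm is separable, and in each coordinate the solution is the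
    soft-thresholding of x at level lambda. *)
Lemma l1_prox_exists (R : realType) (d : nat) (lambda : R) (x : 'cV[R]_d) :
  0 < lambda -> exists z,
    subgradient (fun u => (l1norm u)%:E) z (lambda^-1 *: (x - z)).
Proof.
move=> lambda_gt0.
pose soft (t : R) := if lambda < t then t - lambda
                     else if t < - lambda then t + lambda else 0.
have soft_sub t w : `|soft t| + lambda^-1 * (t - soft t) * (w - soft t) <= `|w|.
  rewrite -(ler_pM2l lambda_gt0) mulrDr !mulrA divff ?gt_eqF // mul1r.
  rewrite /soft; case: ltP => [t_gt|t_le].
    rewrite [`|_ - lambda|]gtr0_norm; last lra.
    by have := ler_norm w; nra.
  case: ltP => [t_lt|t_ge].
    rewrite [`|_ + lambda|]ltr0_norm; last lra.
    by have := ler_norm (- w); rewrite normrN; nra.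
  rewrite normr0 mulr0 add0r !subr0 (le_trans (ler_norm _)) // normrM.
  by rewrite ler_wpM2r // ler_norml t_ge t_le.
exists (\col_i soft (x i 0)); apply/subgradient_l1P => u.
rewrite /l1norm /dot -big_split /=; apply: ler_sum => i _.
by rewrite !mxE soft_sub.
Qed.

Lemma box_coordP (R : realType) (d : nat) (b u : 'cV[R]_d) (delta : R) :
  0 <= delta -> `|u - b| <= delta <-> forall i, `|u i 0 - b i 0| <= delta.
Proof.
move=> delta_ge0; rewrite /Num.Def.normr /= mx_normrE; split.
  move=> /bigmax_leP[_ le_delta] i.
  by have := le_delta (i, 0) isT; rewrite !mxE.
move=> le_delta; apply/bigmax_leP; split=> // -[i j] _.
by rewrite ord1 !mxE /= le_delta.
Qed.

(** A box is a product of intervals, so its projection truncates each coordinate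
    to the corresponding interval. *)
Lemma box_projection_exists (R : realType) (d : nat) (b : 'cV[R]_d)
    (delta : R) (x : 'cV[R]_d) :
  0 <= delta -> exists z,
    subgradient (indicator [set u | `|u - b| <= delta]) z (x - z).
Proof.
move=> delta_ge0.
pose clamp (c t : R) := if c + delta < t then c + delta
                        else if t < c - delta then c - delta else t.
have clamp_in c t : `|clamp c t - c| <= delta.
  by rewrite /clamp ler_norml; case: ltP => ?; [|case: ltP => ?];
     apply/andP; split; lra.
have clamp_obtuse c t w :
    `|w - c| <= delta -> (t - clamp c t) * (w - clamp c t) <= 0.
  rewrite /clamp ler_norml => /andP[? ?].
  by case: ltP => ?; [|case: ltP => ?]; nra.
exists (\col_i clamp (b i 0) (x i 0)); apply/subgradient_indicatorP; split.
  by apply/box_coordP => // i; rewrite mxE.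
move=> u /(box_coordP _ _ delta_ge0) u_in; apply: sumr_le0 => i _.
by rewrite !mxE clamp_obtuse.
Qed.

(** * Feasibility and multipliers *)

(** y^T X lies in the row space of X^T X because it is annihilated by the
    kernel of X^T X, which is the kernel of X: if X^T X K = 0 then the Gram
    matrix of X K vanishes, hence X K = 0. *)
Lemma normal_equations_solvable (R : realFieldType) (n p : nat)
    (X : 'M[R]_(n, p)) (y : 'cV[R]_n) :
  exists beta : 'cV[R]_p, X^T *m X *m beta = X^T *m y.
Proof.
have gram_eq0 k (M : 'M[R]_(n, k)) : M^T *m M = 0 -> M = 0.
  move=> MtM0; apply/matrixP => i j; rewrite [RHS]mxE.
  have sq_ge0 (l : 'I_n) : true -> 0 <= M l j ^+ 2 by rewrite sqr_ge0.
  have /psumr_eq0P : \sum_l M l j ^+ 2 = 0.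
    transitivity ((M^T *m M) j j); last by rewrite MtM0 mxE.
    by rewrite mxE; apply: eq_bigr => l _; rewrite mxE expr2.
  by move=> /(_ sq_ge0 i isT) /eqP; rewrite sqrf_eq0 => /eqP.
have /submxP[w wE] : (y^T *m X <= X^T *m X)%MS.
  set K := cokermx (X^T *m X).
  have XK0 : X *m K = 0.
    apply: gram_eq0; rewrite trmx_mul -!mulmxA [X^T *m _]mulmxA.
    by rewrite mulmx_coker mulmx0.
  by rewrite submxE -mulmxA -/K XK0 mulmx0.
by exists w^T; apply: trmx_inj; rewrite !trmx_mul !trmxK wE.
Qed.

(** Consider triples (u, e, s) with |u| <= e coordinatewise, s >= 0 and
    |A u - s b| <= s delta. On this cone, sum e >= |beta|_1 s: for s > 0 the
    point u / s is feasible and optimality of beta applies; for s = 0 the right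
    side vanishes. Farkas' lemma writes this inequality as a nonnegative
    combination of the constraints, and tau is the difference of the
    coefficients of the upper and lower box constraints. Evaluating the
    combination at (u, |u|, 0) gives - <tau, A u> <= |u|_1 for all u; at
    (0, 0, 1) it gives sup over C of <tau, .> <= - |beta|_1. At beta both are
    equalities, and these are the two subgradient conditions. *)
Lemma l1_box_multiplier (R : realType) (m d : nat) (A : 'M[R]_(m, d))
    (b : 'cV[R]_m) (delta : R) (beta : 'cV[R]_d) :
  let C := [set u : 'cV[R]_m | `|u - b| <= delta] in
  0 <= delta -> C (A *m beta) ->
  (forall u, C (A *m u) -> l1norm beta <= l1norm u) ->
  exists tau,
    subgradient (fun u => (l1norm u)%:E) beta (- (A^T *m tau)) /\
    subgradient (indicator C) (A *m beta) tau.
Proof.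
move=> C delta_ge0 beta_feas beta_min.
pose V := ('cV[R]_d * 'cV[R]_d * R^o)%type.
pose a (i : 'I_d + 'I_d + ('I_m + 'I_m) + unit) (x : V) : R :=
  match i with
  | inl (inl (inl i)) => x.1.2 i 0 - x.1.1 i 0
  | inl (inl (inr i)) => x.1.2 i 0 + x.1.1 i 0
  | inl (inr (inl j)) => (b j 0 + delta) * x.2 - (A *m x.1.1) j 0
  | inl (inr (inr j)) => (A *m x.1.1) j 0 - (b j 0 - delta) * x.2
  | inr _ => x.2
  end.
pose c (x : V) : R := \sum_i x.1.2 i 0 - l1norm beta * x.2.
have lin_a i : scalar (a i).
  move=> k [[u1 e1] s1] [[u2 e2] s2].
  have scaleE (r s : R) : r *: (s : R^o) = r * s by [].
  by case: i => [[[]|[]]|] i; rewrite /a /= ?scaleE ?mulmxDr -?scalemxAr ?mxE;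
     ring.
have lin_c : scalar c.
  move=> k [[u1 e1] s1] [[u2 e2] s2].
  have scaleE (r s : R) : r *: (s : R^o) = r * s by [].
  have -> : c (k *: (u1, e1, s1) + (u2, e2, s2)) =
      \sum_i (k * e1 i 0 + e2 i 0) - l1norm beta * (k * s1 + s2).
    by congr (_ - _); apply: eq_bigr => i _; rewrite !mxE.
  by rewrite big_split -mulr_sumr /c /=; ring.
have c_ge0 x : (forall i, 0 <= a i x) -> 0 <= c x.
  case: x => [[u e] s] ax_ge0.
  have s_ge0 := ax_ge0 (inr tt); rewrite /a /= in s_ge0.
  have u_le_e i : `|u i 0| <= e i 0.
    have := ax_ge0 (inl (inl (inl i))); have := ax_ge0 (inl (inl (inr i))).
    by rewrite ler_norml /a /= => ? ?; apply/andP; split; lra.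
  suff : l1norm beta * s <= l1norm u.
    rewrite subr_ge0 => /le_trans; apply.
    by apply: ler_sum => i _; exact: u_le_e.
  have [->|s_neq0] := eqVneq s 0.
    by rewrite mulr0; apply: sumr_ge0 => i _.
  have s_gt0 : 0 < s by rewrite lt_neqAle eq_sym s_neq0.
  have -> : l1norm u = l1norm (s^-1 *: u) * s.
    rewrite /l1norm mulr_suml; apply: eq_bigr => i _.
    by rewrite mxE normrM ger0_norm ?invr_ge0 // mulrAC mulVf ?mul1r.
  rewrite ler_pM2r //; apply/beta_min/box_coordP => // j.
  have := ax_ge0 (inl (inr (inl j))); have := ax_ge0 (inl (inr (inr j))).
  have -> : (A *m (s^-1 *: u)) j 0 = s^-1 * (A *m u) j 0.
    by rewrite -scalemxAr mxE.
  rewrite /a /=; set t := (A *m u) j 0 => lo up.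
  have -> : s^-1 * t - b j 0 = (t - b j 0 * s) / s by field.
  rewrite normf_div (gtr0_norm s_gt0) ler_pdivrMr // ler_norml.
  by apply/andP; split; lra.
have [mult mult_ge0 cE] := farkas lin_a lin_c c_ge0.
pose up j := mult (inl (inr (inl j))).
pose lo j := mult (inl (inr (inr j))).
pose tau : 'cV[R]_m := \col_j (up j - lo j).
have pairing u : - dot tau (A *m u) <= l1norm u.
  have := cE (u, \col_i `|u i 0|, 0).
  rewrite /c /= mulr0 subr0 (eq_bigr (fun i => `|u i 0|)); last first.
    by move=> i _; rewrite mxE.
  rewrite [LHS](_ : _ = l1norm u) // => ->.
  rewrite !big_sumType /=.
  set S1 := \sum_i _; set S2 := \sum_i _.
  set S3 := \sum_j _; set S4 := \sum_j _; set S5 := \sum_i _.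
  have S1_ge0 : 0 <= S1.
    by apply: sumr_ge0 => i _; rewrite mulr_ge0 // mxE subr_ge0 ler_norm.
  have S2_ge0 : 0 <= S2.
    apply: sumr_ge0 => i _; rewrite mulr_ge0 // mxE.
    by have := ler_norm (- u i 0); rewrite normrN; lra.
  have S5_0 : S5 = 0 by apply: big1 => i _; rewrite mulr0.
  suff : - dot tau (A *m u) = S3 + S4 by lra.
  rewrite -sumrN -big_split; apply: eq_bigr => j _.
  by rewrite /= !mulr0 mxE /up /lo; ring.
have support : dot tau b + delta * \sum_j (up j + lo j) <= - l1norm beta.
  set T := \sum_j (up j + lo j); have := cE (0, 0, 1).
  rewrite /c /= mulr1 big1 => [|i _]; last by rewrite mxE.
  rewrite sub0r => ->; rewrite !big_sumType /=.
  set S1 := \sum_i _; set S2 := \sum_i _.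
  set S3 := \sum_j _; set S4 := \sum_j _; set S5 := \sum_i _.
  have S1_0 : S1 = 0 by apply: big1 => i _; rewrite !mxE subrr mulr0.
  have S2_0 : S2 = 0 by apply: big1 => i _; rewrite !mxE addr0 mulr0.
  have S5_ge0 : 0 <= S5 by apply: sumr_ge0 => i _; rewrite mulr1.
  suff : dot tau b + delta * T = S3 + S4 by lra.
  rewrite mulr_sumr -!big_split; apply: eq_bigr => j _.
  by rewrite /= mulmx0 !mxE /up /lo; ring.
(* Each up j + lo j dominates |tau j|, so the right side bounds the support
   function of the box. *)
have box_dot u : C u -> dot tau u <= dot tau b + delta * \sum_j (up j + lo j).
  move=> /(box_coordP _ _ delta_ge0) u_in.
  rewrite -lerBlDl -dotBr mulr_sumr; apply: ler_sum => j _.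
  rewrite !mxE; have := u_in j; rewrite ler_norml => /andP[? ?].
  have : 0 <= up j := mult_ge0 _; have : 0 <= lo j := mult_ge0 _.
  by move=> ? ?; nra.
have dotN u : dot (- (A^T *m tau)) u = - dot tau (A *m u).
  by rewrite -scaleN1r dotZl dot_trmx mulN1r.
exists tau; split.
  apply/subgradient_l1P => u; rewrite dotBr !dotN.
  by have := pairing u; have := box_dot _ beta_feas; lra.
apply/subgradient_indicatorP; split=> // u /box_dot; rewrite dotBr.
by have := pairing beta; lra.
Qed.

(** * The fixed-point characterization *)

Theorem theorem2p1 (R : realType) (n p : nat) (X : 'M[R]_(n, p))
    (y : 'cV[R]_n) (delta : R)
    (X_col_neq0 : forall i : 'I_p, col i X != 0) (delta_gt0 : 0 < delta) :
  let D : 'M[R]_p := colnorm_mx X in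
  let A : 'M[R]_p := invmx D *m X^T *m X in
  let b : 'cV[R]_p := invmx D *m X^T *m y in
  let C : set 'cV[R]_p := [set u : 'cV[R]_p | `|u - b| <= delta] in
  let solutions : set 'cV[R]_p :=
    argmin (fun beta : 'cV[R]_p =>
      ((l1norm beta)%:E + indicator C (A *m beta))%E) in
  let l1 : 'cV[R]_p -> \bar R := fun u => (l1norm u)%:E in
  let fixed_point_eqs (alpha lambda : R) (beta tau : 'cV[R]_p) : Prop :=
    beta = prox (1 / alpha) l1 (beta - (lambda / alpha) *: (A^T *m tau)) /\
    tau = (id \- prox 1 (indicator C)) (A *m beta + tau) in
  (forall beta : 'cV[R]_p, solutions beta ->
     forall alpha lambda : R, 0 < alpha -> 0 < lambda ->
     exists tau : 'cV[R]_p, fixed_point_eqs alpha lambda beta tau) /\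
  (forall beta tau : 'cV[R]_p,
     (exists alpha lambda : R,
        [/\ 0 < alpha, 0 < lambda & fixed_point_eqs alpha lambda beta tau]) ->
     solutions beta).
Proof.
move=> D A b C solutions l1 fixed_point_eqs.
have fixed_point_eqsP alpha lambda beta tau : 0 < alpha ->
    fixed_point_eqs alpha lambda beta tau <->
    subgradient l1 beta (- (A^T *m (lambda *: tau))) /\
    subgradient (indicator C) (A *m beta) tau.
  move=> alpha_gt0; rewrite /fixed_point_eqs.
  have step_gt0 : 0 < 1 / alpha by rewrite div1r invr_gt0.
  have l1_grad : (1 / alpha)^-1 *:
      (beta - lambda / alpha *: (A^T *m tau) - beta) =
      - (A^T *m (lambda *: tau)).
    rewrite addrAC subrr add0r scalerN scalerA -scalemxAr; congr (- (_ *: _)).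
    by field; rewrite gt_eqF.
  have box_grad : 1^-1 *: (A *m beta + tau - A *m beta) = tau.
    by rewrite invr1 scale1r addrAC subrr add0r.
  have := prox_eqP (f := l1) beta step_gt0
    (l1_prox_exists (beta - lambda / alpha *: (A^T *m tau)) step_gt0).
  rewrite l1_grad => <-.
  have proj_exists : exists z0,
      subgradient (indicator C) z0 (1^-1 *: (A *m beta + tau - z0)).
    have [z0 ?] := box_projection_exists b (A *m beta + tau) (ltW delta_gt0).
    by exists z0; rewrite invr1 scale1r.
  have := prox_eqP (A *m beta) ltr01 proj_exists; rewrite box_grad => <-.
  set P := prox 1 _ _.
  suff -> : (tau = (id \- prox 1 (indicator C)) (A *m beta + tau)) <->
      A *m beta = P by [].
  rewrite /= -/P; split=> [tauE|<-]; last by rewrite addrAC subrr add0r.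
  apply/eqP; rewrite -subr_eq0 -(inj_eq (addrI tau)) addr0 addrCA.
  by rewrite [X in _ == X]tauE addrA.
(* Feasibility of beta matters: an infeasible beta of small l1 norm satisfies
   the right side without being a solution. *)
have solutionsP beta : C (A *m beta) -> solutions beta <->
    forall u, C (A *m u) -> l1norm beta <= l1norm u.
  move=> beta_feas; rewrite /solutions /argmin /= /indicator mem_set // adde0.
  split=> beta_min u.
    by move=> u_feas; have := beta_min u; rewrite mem_set // adde0 lee_fin.
  case: ifPn => [|_]; last by rewrite addey ?leey.
  by rewrite inE adde0 lee_fin => /beta_min.
split=> [beta sol alpha lambda alpha_gt0 lambda_gt0|].
  have beta_feas : C (A *m beta).
    have [u uE] := normal_equations_solvable X y.
    have Au : A *m u = b by rewrite /A /b -!mulmxA -uE !mulmxA.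
    apply: contrapT => beta_infeas; have := sol u.
    rewrite /indicator Au memNset // mem_set; last first.
      by rewrite /C /= subrr normr0 ltW.
    by rewrite adde0 addey.
  have [tau [l1_sub box_sub]] := l1_box_multiplier (ltW delta_gt0) beta_feas
    ((solutionsP _ beta_feas).1 sol).
  (* The l1 condition involves lambda times the multiplier, whereas normality
     to the box is unaffected by positive scaling. *)
  exists (lambda^-1 *: tau); apply/fixed_point_eqsP => //; split.
    by rewrite scalerA divff ?gt_eqF // scale1r.
  apply/subgradient_indicatorP; split=> // u u_feas.
  rewrite dotZl pmulr_rle0 ?invr_gt0 //.
  by have /subgradient_indicatorP[_] := box_sub; apply.
move=> beta tau [alpha [lambda [alpha_gt0 lambda_gt0]]].
move=> /(fixed_point_eqsP _ _ _ _ alpha_gt0)[/subgradient_l1P l1_sub].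
move=> /subgradient_indicatorP[beta_feas box_sub].
apply/solutionsP => // u u_feas; apply: le_trans (l1_sub u).
rewrite lerDl -scaleN1r dotZl dot_trmx mulN1r oppr_ge0 dotZl.
rewrite pmulr_rle0 // mulmxBr; exact: box_sub.
Qed.
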